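(* Fix $q\in(0,1)$ and let $\Gamma_n=P_{k_n}$ be the path on $k_n$ vertices ($2\le k_n\le n$). If $$\frac{Q_nk_n}{n^3}\to0,$$ then weak detection is impossible with query budget $Q_n$. In particular, if $k_n=o(n)$, then weak detection is impossible even under full observation (i.e. with $Q_n=\binom n2$).
   Context: Setup. Under $\mathcal H_0$, $G$ is a random graph on $[n]=\{1,\dots,n\}$ in which each pair in $\binom{[n]}{2}$ is an edge independently with probability $q$. Under $\mathcal H_1$, a copy $\Gamma_n^\star$ is drawn uniformly from the set of all subgraphs of the complete graph on $[n]$ isomorphic to $\Gamma_n$; all edges of $\Gamma_n^\star$ are in $G$, and every other pair is an edge independently with probability $q$. For a query set $\mathcal Q\subseteq\binom{[n]}{2}$ (chosen non-adaptively), the transcript is $G_{\mathcal Q}=(\mathbf 1\{e\in e(G)\})_{e\in\mathcal Q}$, with laws $\mathbb P_{\mathcal H_0,\mathcal Q}$, $\mathbb P_{\mathcal H_1,\mathcal Q}$. The optimal risk under budget $Q_n$ is $R^\star_{n,Q_n}=1-\sup_{|\mathcal Q|\le Q_n} d_{\mathrm{TV}}(\mathbb P_{\mathcal H_1,\mathcal Q},\mathbb P_{\mathcal H_0,\mathcal Q})$. Weak detection is impossible with budget $Q_n$ if $\lim_nR^\star_{n,Q_n}=1$. *)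

(* Defs.v *)
From HB Require Import structures.
From mathcomp Require Import all_boot all_order all_algebra.
From mathcomp Require Import all_classical all_reals all_analysis.

Set Implicit Arguments.
Unset Strict Implicit.
Unset Printing Implicit Defensive.

Import Order.TTheory GRing.Theory Num.Theory.
Import numFieldNormedType.Exports.

Local Open Scope classical_set_scope.
Local Open Scope ring_scope.

Definition edge (n : nat) : finType := {e : {set 'I_n} | #|e| == 2%N}.

(* A simple graph on the whole vertex set 'I_n is its set of edges. *)
Definition graph (n : nat) : finType := {set edge n}.

Definition adj (n : nat) (G : graph n) (x y : 'I_n) : bool :=
  [exists e in G, val e == [set x; y]%SET].

Definition path_graph (k : nat) : graph k :=
  [set e : edge k |
    [exists i : 'I_k, exists j : 'I_k,
       (val e == [set i; j]%SET) && (val j == (val i).+1)]]%SET.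

(* A subgraph of the complete graph on 'I_n is a vertex set together with a set
   of edges contained in it; [copies n H] collects those isomorphic to H. *)
Definition copies (n k : nat) (H : graph k) : {set {set 'I_n} * graph n} :=
  [set S : {set 'I_n} * graph n |
    [forall e in S.2, val e \subset S.1] &&
    [exists f : {ffun 'I_k -> 'I_n},
       [&& injectiveb f, [set f x | x : 'I_k]%SET == S.1
         & [forall x, forall y, adj H x y == adj S.2 (f x) (f y)]]]]%SET.

(* Laws on a finite type are given by their probability mass functions. *)
Section FiniteLaws.
Variable R : realType.

Definition prob (T : finType) (P : T -> R) (A : {set T}) : R :=
  \sum_(x in A) P x.

Definition dTV (T : finType) (P P' : T -> R) : R :=
  sup [set `|prob P A - prob P' A| | A in [set: {set T}]].

Definition law_of (T U : finType) (X : T -> U) (P : T -> R) (u : U) : R :=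
  prob P (finset (fun x => X x == u)).

Definition indep_edges_law (n : nat) (p : edge n -> R) (G : graph n) : R :=
  \prod_(e : edge n) (if e \in G then p e else 1 - p e).

Definition null_law (q : R) (n : nat) : graph n -> R :=
  indep_edges_law (fun=> q).

Definition planted_law (q : R) (n k : nat) (H : graph k) (G : graph n) : R :=
  (\sum_(S in copies n H)
     indep_edges_law (fun e => if e \in S.2 then 1 else q) G)
  / #|copies n H|%:R.

Definition transcript (n : nat) (Q : {set edge n}) (G : graph n) :
    {ffun {e : edge n | e \in Q} -> bool} :=
  [ffun e => val e \in G].

Definition optimal_risk (q : R) (n k : nat) (H : graph k) (b : nat) : R :=
  1 - sup [set dTV (law_of (transcript Q) (planted_law q H))
                   (law_of (transcript Q) (@null_law q n))
          | Q in [set Q : {set edge n} | (#|Q| <= b)%N]].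

Definition weak_detection_impossible (q : R) (k : nat -> nat)
    (H : forall n, graph (k n)) (b : nat -> nat) : Prop :=
  optimal_risk q n (H n) (b n) @[n --> \oo] --> (1 : R).

End FiniteLaws.

(* Main.v *)
Require Import Defs.
From mathcomp Require Import all_boot all_order all_fingroup all_algebra.
From mathcomp Require Import all_classical all_reals all_analysis.
From mathcomp Require Import ring lra zify.
Set Implicit Arguments.
Unset Strict Implicit.
Unset Printing Implicit Defensive.
Import Order.TTheory GRing.Theory Num.Theory.
Import numFieldNormedType.Exports.
Local Open Scope classical_set_scope.
Local Open Scope ring_scope.

(** Second moment method.  Let E(s) be the edge set of the planted path
    obtained by relabelling a fixed path with a uniform permutation s of the
    n vertices.  For independent s and t put
    X = #|E(s) :&: E(t) :&: Q|.  The squared total variation distance between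
    the transcripts is at most the chi-square divergence E[q^-X] - 1, and
    (E[q^-X] - 1)^2 <= P(X > 0) E[q^-2X] <= E[X] E[q^-2X].
    By linearity E[X] <= #|Q| (4 k / n^2)^2 <= 16 #|Q| k / n^3, which tends to
    0, so it is enough to bound E[q^-2X] uniformly in n.  Fix t and split the
    path carrying s into two halves (AM-GM).  Along one half, reveal
    s vertex by vertex: at least n/2 values remain possible at every step and
    E(t) has degree at most 2, so each step multiplies the expectation by at
    most 1 + O(1/n), and there are at most n/2 steps. *)

(** Cauchy-Schwarz: the quadratic form with coefficients [A], [B], [C] is a sum of squares, and its
    value at [(B, A)] is [A * (A * C - B ^+ 2)]. The degenerate case [A = 0] forces every [u i] to
    vanish. *)
Lemma sqr_sum_mul_le (R : realFieldType) (I : finType) (u v : I -> R) :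
  (\sum_i u i * v i) ^+ 2 <= (\sum_i u i ^+ 2) * (\sum_i v i ^+ 2).
Proof.
set A := \sum_i u i ^+ 2; set B := \sum_i u i * v i; set C := \sum_i v i ^+ 2.
have A_ge0 : 0 <= A by apply: sumr_ge0 => i _; exact: sqr_ge0.
have quad (t s : R) : 0 <= A * t ^+ 2 - 2 * B * t * s + C * s ^+ 2.
  have -> : A * t ^+ 2 - 2 * B * t * s + C * s ^+ 2 =
            \sum_i (u i * t - v i * s) ^+ 2.
    rewrite /A /B /C mulr_sumr !mulr_suml -sumrB -big_split /=.
    by apply: eq_bigr => i _; ring.
  by apply: sumr_ge0 => i _; exact: sqr_ge0.
have [A0|A_neq0] := eqVneq A 0.
  have u0 i : u i = 0.
    apply/eqP; rewrite -sqrf_eq0; apply/eqP.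
    by move/psumr_eq0P: A0 => -> // j _; exact: sqr_ge0.
  by rewrite A0 /B big1 ?expr0n ?mul0r // => i _; rewrite u0 mul0r.
have A_gt0 : 0 < A by rewrite lt_def A_neq0.
have := quad B A.
have -> : A * B ^+ 2 - 2 * B * B * A + C * A ^+ 2 = A * (A * C - B ^+ 2) by ring.
by rewrite pmulr_rge0 // subr_ge0.
Qed.

(** * Product laws on graphs and the laws of their transcripts *)

Section EdgeLaws.
Variables (R : realType) (n : nat).
Implicit Types (p : edge n -> R) (G S Q : graph n).

Lemma sum_prod_edges (F F' : edge n -> R) :
  \sum_(G : graph n) \prod_e (if e \in G then F e else F' e) =
  \prod_e (F e + F' e).
Proof. by rewrite bigA_distr; apply: eq_bigl => G; rewrite inE. Qed.

Lemma sum_indep_edges_law p : \sum_G indep_edges_law p G = 1.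
Proof.
rewrite sum_prod_edges big1 // => e _; exact: subrKC.
Qed.

(** The transcript law is a product over edges in which an unqueried edge contributes
    [p e + (1 - p e) = 1]. Planted edges outside [Q] can therefore be erased. *)
Lemma law_of_transcript_restr (Q : {set edge n}) p p' :
  {in Q, p =1 p'} ->
  law_of (transcript Q) (indep_edges_law p) =1
  law_of (transcript Q) (indep_edges_law p').
Proof.
move=> pp' u.
(* Indicator that status [b] of the edge [e] is compatible with [u]; unqueried edges get the
   constant 1, being unconstrained. *)
pose agree (e : edge n) (b : bool) : R :=
  if insub e is Some e' then (u e' == b)%:R else 1.
have lawE (r : edge n -> R) : law_of (transcript Q) (indep_edges_law r) u =
    \prod_e (r e * agree e true + (1 - r e) * agree e false).
  rewrite -sum_prod_edges /law_of /prob big_mkcond; apply: eq_bigr => G _.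
  rewrite inE; case: eqP => [uE|neq].
    apply: eq_bigr => e _; rewrite /agree; case: insubP => [e' _ <-|_].
      by rewrite -uE ffunE; case: (_ \in G); rewrite eqxx mulr1.
    by rewrite !mulr1.
  have /existsP[e' /negPf ue'] : [exists e', u e' != (val e' \in G)].
    apply/contra_notT: neq; rewrite negb_exists => /forallP eqs.
    by apply/ffunP => e'; rewrite ffunE; move/eqP: (negPn (eqs e')).
  symmetry; rewrite (bigD1 (val e')) //= /agree valK.
  by case: ifP ue' => _ ->; rewrite mulr0 mul0r.
rewrite !lawE; apply: eq_bigr => e _; rewrite /agree; case: insubP => [e' eQ _|_].
  by rewrite pp'.
by rewrite !mulr1 !subrKC.
Qed.

Lemma prob_law_of (T U : finType) (X : T -> U) (P : T -> R) (A : {set U}) :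
  prob (law_of X P) A = prob P (X @^-1: A).
Proof.
rewrite /law_of /prob (partition_big X (mem A)) /=; last by move=> x; rewrite inE.
apply: eq_bigr => u uA; apply: eq_bigl => x; rewrite !inE.
by case: eqP => [->|_]; rewrite ?andbT ?andbF.
Qed.

End EdgeLaws.

(** * Chi-square bound for mixtures of planted laws *)

Section SecondMoment.
Variables (R : realType) (q : R) (n : nat).
Hypothesis hq : 0 < q < 1.
Implicit Types (G S Q : graph n).

Definition planted_edges_law S : graph n -> R :=
  indep_edges_law (fun e => if e \in S then 1 else q).

Let q_gt0 : 0 < q. Proof. by case/andP: hq. Qed.
Let q_neq0 : q != 0. Proof. exact: lt0r_neq0. Qed.
Let q'_gt0 : 0 < 1 - q. Proof. by rewrite subr_gt0; case/andP: hq. Qed.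

Lemma null_law_gt0 G : 0 < null_law q G.
Proof. by apply: prodr_gt0 => e _; case: ifP. Qed.

(** The likelihood ratios factor over edges: an edge common to [S] and [S'] contributes [q^-1], any
    other edge contributes 1. *)
Lemma planted_edges_law_inner S S' :
  \sum_G planted_edges_law S G * planted_edges_law S' G / null_law q G =
  q^-1 ^+ #|S :&: S'|.
Proof.
rewrite -prodr_const [RHS]big_mkcond /=.
transitivity (\prod_e ((if e \in S then 1 else q) * (if e \in S' then 1 else q) / q
   + (1 - (if e \in S then 1 else q)) * (1 - (if e \in S' then 1 else q)) / (1 - q))).
  rewrite -sum_prod_edges; apply: eq_bigr => G _.
  rewrite /planted_edges_law /null_law /indep_edges_law -prodfV -!big_split /=.
  by apply: eq_bigr => e _; case: ifP.
apply: eq_bigr => e _; rewrite inE.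
have q'_neq0 : 1 - q != 0 by exact: lt0r_neq0.
by case: (e \in S); case: (e \in S'); rewrite /=; field; rewrite ?q_neq0 ?q'_neq0.
Qed.

(** The right-hand side is the chi-square divergence of the uniform mixture from the null law; it
    dominates by Cauchy-Schwarz with weights the square root of the null law. *)
Lemma sqr_prob_mixture_le (I : finType) (S : I -> graph n) (A : {set graph n}) :
  (0 < #|I|)%N ->
  (\sum_(G in A) ((\sum_i planted_edges_law (S i) G) / #|I|%:R - null_law q G)) ^+ 2
  <= (\sum_i \sum_j (q^-1 ^+ #|S i :&: S j| - 1)) / #|I|%:R ^+ 2.
Proof.
move=> I_gt0; have N_neq0 : #|I|%:R != 0 :> R by rewrite pnatr_eq0 -lt0n.
set N := #|I|%:R; pose P G := \sum_i planted_edges_law (S i) G.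
rewrite big_mkcond /=.
pose u G : R := if G \in A then Num.sqrt (null_law q G) else 0.
pose v G : R := (P G / N - null_law q G) / Num.sqrt (null_law q G).
have s_gt0 G : 0 < Num.sqrt (null_law q G) by rewrite sqrtr_gt0 null_law_gt0.
have sK G : Num.sqrt (null_law q G) ^+ 2 = null_law q G.
  by rewrite sqr_sqrtr // ltW // null_law_gt0.
rewrite (_ : \sum_G _ = \sum_G u G * v G); last first.
  apply: eq_bigr => G _; rewrite /u /v; case: ifP => _; last by rewrite mul0r.
  by rewrite [RHS]mulrC divfK // lt0r_neq0.
apply: (le_trans (sqr_sum_mul_le _ _)).
have u_le1 : \sum_G u G ^+ 2 <= 1.
  rewrite -(sum_indep_edges_law (fun _ : edge n => q)); apply: ler_sum => G _.
  rewrite /u; case: ifP => _; first by rewrite sK.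
  by rewrite expr0n ltW // null_law_gt0.
have v_ge0 : 0 <= \sum_G v G ^+ 2 by apply: sumr_ge0 => G _; exact: sqr_ge0.
apply: (le_trans (ler_piMl v_ge0 u_le1)).
rewrite le_eqVlt; apply/orP; left; apply/eqP.
have sumP : \sum_G P G = N.
  rewrite exchange_big /= (eq_bigr (fun=> 1)) => [|i _].
    by rewrite sumr_const.
  exact: sum_indep_edges_law.
(* After expanding the square, the cross term sums to 2 and the last term to 1, which leaves the
   normalised second moment minus 1. *)
transitivity (\sum_G (P G * P G / null_law q G / N ^+ 2 - 2 * (P G / N) + null_law q G)).
  apply: eq_bigr => G _; rewrite /v expr_div_n sK.
  by have := lt0r_neq0 (null_law_gt0 G) => h; field; rewrite N_neq0 h.
rewrite big_split sumrB /= -mulr_sumr -mulr_suml -mulr_suml sumP.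
rewrite sum_indep_edges_law divff //.
have -> : \sum_G P G * P G / null_law q G = \sum_i \sum_j q^-1 ^+ #|S i :&: S j|.
  transitivity (\sum_G \sum_i \sum_j
      planted_edges_law (S i) G * planted_edges_law (S j) G / null_law q G).
    apply: eq_bigr => G _; rewrite /P !mulr_suml; apply: eq_bigr => i _.
    by rewrite mulr_sumr mulr_suml.
  rewrite exchange_big; apply: eq_bigr => i _; rewrite exchange_big.
  by apply: eq_bigr => j _; exact: planted_edges_law_inner.
have -> : \sum_i \sum_j (q^-1 ^+ #|S i :&: S j| - 1) =
   (\sum_i \sum_j q^-1 ^+ #|S i :&: S j|) - N ^+ 2.
  under eq_bigr do rewrite sumrB sumr_const.
  by rewrite sumrB sumr_const -mulr_natr.
by field.
Qed.

End SecondMoment.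

(** * Uniform copies as images under a uniform permutation *)

Lemma set2_eqP (T : finType) (a b c d : T) :
  [set a; b]%SET = [set c; d]%SET -> (a = c /\ b = d) \/ (a = d /\ b = c).
Proof.
move=> eq_ab.
have mem x : (x == a) || (x == b) = (x == c) || (x == d).
  by have := congr1 (fun A : {set T} => x \in A) eq_ab; rewrite !inE.
have := mem a; have := mem b; have := mem c; have := mem d.
rewrite !eqxx /= !orbT.
by move=> /orP[]/eqP ? /orP[]/eqP ? /esym/orP[]/eqP ? /esym/orP[]/eqP ?; subst; auto.
Qed.

Section Copies.
Variables n k : nat.
Implicit Types (H : graph k) (f : 'I_k -> 'I_n) (t : 'S_n).

Lemma adj_sym m (G : graph m) x y : adj G x y = adj G y x.
Proof. by apply: eq_existsb => e; congr (_ && (_ == _)); exact: finset.setUC. Qed.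

Lemma adj_neq m (G : graph m) x y : adj G x y -> x != y.
Proof.
case/existsP=> e /andP[_ /eqP eE].
by have := valP e; rewrite eE cards2; case: (x != y).
Qed.

Definition image_copy H f : {set 'I_n} * graph n :=
  ([set f x | x : 'I_k]%SET,
   [set e : edge n | [exists x, exists y,
      adj H x y && (val e == [set f x; f y]%SET)]]%SET).

Lemma eq_image_copy H f f' : f =1 f' -> image_copy H f = image_copy H f'.
Proof.
move=> ff'; congr pair; first exact: eq_imset.
apply/setP=> e; rewrite !inE; apply: eq_existsb => x; apply: eq_existsb => y.
by rewrite !ff'.
Qed.

Lemma adj_image_copy H f x y : injective f ->
  adj (image_copy H f).2 (f x) (f y) = adj H x y.
Proof.
move=> f_inj; apply/existsP/idP => [[e /andP[]]|Hxy].
  rewrite inE => /existsP[x' /existsP[y' /andP[Hxy' /eqP->]]] /eqP/set2_eqP.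
  by case=> -[/f_inj<- /f_inj<-] //; rewrite adj_sym.
have fxy2 : #|[set f x; f y]%SET| == 2%N.
  by rewrite cards2 (inj_eq f_inj) (adj_neq Hxy).
exists (Sub [set f x; f y]%SET fxy2 : edge n); rewrite SubK eqxx andbT inE.
by apply/existsP; exists x; apply/existsP; exists y; rewrite Hxy SubK eqxx.
Qed.

(** Parametrises the copies by injections, which later extend to permutations of the whole vertex
    set. *)
Lemma image_copyP H S :
  reflect (exists2 f, injective f & S = image_copy H f) (S \in copies n H).
Proof.
apply: (iffP idP) => [|[f f_inj ->]]; rewrite inE.
  case/andP=> /forallP eS /existsP[f /and3P[/injectiveP f_inj /eqP fS /forallP adjS]].
  exists f => //; rewrite [LHS]surjective_pairing /image_copy fS; congr pair.
  apply/setP => e; rewrite inE; apply/idP/idP => [eS2|].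
    have /cards2P[a [b [neq_ab eE]]] := valP e.
    have /fintype.subsetP sub : val e \subset S.1 by have /implyP/(_ eS2) := eS e.
    have /imsetP[x _ ax] : a \in [set f x | x : 'I_k]%SET.
      by rewrite fS sub // eE !inE eqxx.
    have /imsetP[y _ b_y] : b \in [set f x | x : 'I_k]%SET.
      by rewrite fS sub // eE !inE eqxx orbT.
    apply/existsP; exists x; apply/existsP; exists y; rewrite -ax -b_y eE eqxx andbT.
    have /forallP/(_ y)/eqP -> := adjS x.
    by apply/existsP; exists e; rewrite eS2 -ax -b_y eE eqxx.
  case/existsP=> x /existsP[y /andP[Hxy /eqP eE]].
  move: Hxy; have /forallP/(_ y)/eqP -> := adjS x.
  case/existsP=> e' /andP[e'S /eqP e'E]; rewrite (_ : e = e') //.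
  by apply: val_inj; rewrite eE e'E.
apply/andP; split.
  apply/forallP=> e; apply/implyP; rewrite inE => /existsP[x /existsP[y /andP[_ /eqP->]]].
  by apply/fintype.subsetP => z; rewrite !inE => /orP[]/eqP->; exact: imset_f.
apply/existsP; exists [ffun x => f x]; apply/and3P; split.
- by apply/injectiveP => x y; rewrite !ffunE => /f_inj.
- by apply/eqP/eq_imset => x; rewrite ffunE.
- by apply/forallP=> x; apply/forallP=> y; rewrite !ffunE adj_image_copy.
Qed.

Lemma image_copy_perm H f f' t :
  image_copy H f = image_copy H f' -> image_copy H (t \o f) = image_copy H (t \o f').
Proof.
(* The relabelled copy is computed from the copy alone, so it does not depend on the map that
   produced it. *)
have E g : image_copy H (t \o g) = ([set t x | x in (image_copy H g).1]%SET,
  [set e : edge n | [exists e' in (image_copy H g).2,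
     val e == [set t x | x in val e']%SET]]%SET).
  have im2 x y : [set t z | z in [set x; y]%SET]%SET = [set t x; t y]%SET.
    by rewrite imsetU !imset_set1.
  congr pair; first by rewrite -imset_comp.
  apply/setP=> e; rewrite !inE; apply/existsP/existsP.
    case=> x /existsP[y /andP[Hxy /eqP eE]].
    have e'2 : #|[set g x; g y]%SET| == 2%N.
      by rewrite -(card_imset _ (@perm_inj _ t)) im2; have := valP e; rewrite eE.
    exists (Sub [set g x; g y]%SET e'2 : edge n); rewrite inE SubK im2 eE eqxx andbT.
    by apply/existsP; exists x; apply/existsP; exists y; rewrite Hxy eqxx.
  case=> e' /andP[]; rewrite inE => /existsP[x /existsP[y /andP[Hxy /eqP e'E]]] /eqP eE.
  by exists x; apply/existsP; exists y; rewrite Hxy eE e'E im2 eqxx.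
by move=> eqH; rewrite !E eqH.
Qed.

Hypothesis le_kn : (k <= n)%N.

(** Induction on the number of prescribed values: a transposition moves the next value into place,
    and injectivity of [f] and of the current permutation protects the earlier ones. *)
Lemma perm_extend f : injective f ->
  exists t : 'S_n, forall i, t (widen_ord le_kn i) = f i.
Proof.
move=> f_inj.
suff [t tE] : exists t : 'S_n, forall i : 'I_k, (i < k)%N -> t (widen_ord le_kn i) = f i.
  by exists t => i; exact: tE.
suff IH j : (j <= k)%N ->
    exists t : 'S_n, forall i : 'I_k, (i < j)%N -> t (widen_ord le_kn i) = f i.
  exact: IH.
elim: j => [_|j IHj lt_jk]; first by exists 1%g.
have [t tE] := IHj (ltnW lt_jk).
pose j' := Ordinal lt_jk.
exists (t * tperm (t (widen_ord le_kn j')) (f j'))%g => i; rewrite ltnS leq_eqVlt permM.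
case/orP=> [/eqP ij|lt_ij].
  by rewrite (_ : i = j') ?tpermL //; exact: val_inj.
have neq_ij : i != j' by rewrite -val_eqE /= ltn_eqF.
rewrite tpermD; first exact: tE.
  by rewrite (inj_eq perm_inj) -val_eqE /= gtn_eqF.
by rewrite tE // (inj_eq f_inj) eq_sym.
Qed.

(* 'S_n permutes the copies of H transitively, so the fibres of
   t |-> image_copy H (t \o widen_ord le_kn) all have the same size. *)
Lemma sum_copies_perm (R : numFieldType) H (F : {set 'I_n} * graph n -> R) :
  (\sum_(S in copies n H) F S) / #|copies n H|%:R =
  (\sum_(t : 'S_n) F (image_copy H (t \o widen_ord le_kn))) / #|{perm 'I_n}|%:R.
Proof.
pose copy (t : 'S_n) := image_copy H (t \o widen_ord le_kn).
have w_inj : injective (widen_ord le_kn) by move=> x y /(congr1 val)/= /val_inj.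
have copyP t : copy t \in copies n H.
  apply/image_copyP; exists (t \o widen_ord le_kn) => //.
  by apply: inj_comp => //; exact: perm_inj.
have copy_onto S : S \in copies n H -> exists t, S = copy t.
  case/image_copyP=> f /perm_extend[t tE] ->; exists t.
  by apply: eq_image_copy => x; rewrite /= tE.
pose c S := #|[set t | copy t == S]%SET|.
(* Right multiplication by [s^-1 * s'] embeds the fibre over [copy s] into the fibre over [copy s'];
   exchanging the two copies gives equality. *)
have c_le S S' : S \in copies n H -> S' \in copies n H -> (c S <= c S')%N.
  move=> /copy_onto[s ->] /copy_onto[s' ->].
  rewrite /c -(card_imset _ (@mulIg _ (s^-1 * s')%g)); apply: subset_leq_card.
  apply/fintype.subsetP=> _ /imsetP[t + ->]; rewrite !inE => /eqP copy_ts; apply/eqP.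
  have copyM (u v : 'S_n) : copy (u * v)%g = image_copy H (v \o (u \o widen_ord le_kn)).
    by apply: eq_image_copy => x; rewrite /= permM.
  by rewrite copyM (image_copy_perm _ copy_ts) -copyM mulKVg.
have sumE (F' : {set 'I_n} * graph n -> R) :
    \sum_t F' (copy t) = (c (copy 1%g))%:R * \sum_(S in copies n H) F' S.
  rewrite (partition_big copy (mem (copies n H))) /=; last by move=> t _; exact: copyP.
  rewrite mulr_sumr; apply: eq_bigr => S SH.
  rewrite (eq_bigr (fun=> F' S)); last by move=> t /eqP ->.
  rewrite sumr_const mulr_natl; congr (_ *+ _).
  transitivity (c S); first by apply: eq_card => t; rewrite !inE.
  by apply/eqP; rewrite eqn_leq !c_le ?copyP.
have card_perm : #|{perm 'I_n}|%:R = (c (copy 1%g))%:R * #|copies n H|%:R :> R.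
  by have := sumE (fun=> 1); rewrite !sumr_const.
rewrite sumE card_perm -mulf_div divff ?mul1r // pnatr_eq0 -lt0n.
by apply/card_gt0P; exists 1%g; rewrite inE.
Qed.

End Copies.

(** * Revealing a uniform permutation value by value *)

Section RandomPermutation.
Variables (R : realType) (n : nat).

(* Exchangeability: precomposing s with tperm p j, for j outside W, leaves F s
   unchanged and replaces s p by s j. *)
Lemma sum_perm_reveal (W : {set 'I_n}) (p : 'I_n) (F : 'S_n -> 'I_n -> R) :
  p \notin W -> (forall s x, 0 <= F s x) ->
  (forall s t : 'S_n, {in W, s =1 t} -> F s =1 F t) ->
  #|~: W|%:R * (\sum_s F s (s p)) <= \sum_s \sum_x F s x.
Proof.
move=> pW F_ge0 F_loc.
have swap j : j \in ~: W -> \sum_s F s (s p) = \sum_s F s (s j).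
  rewrite inE => jW.
  rewrite (reindex_inj (mulgI (tperm p j))) /=; apply: eq_bigr => s _.
  rewrite permM tpermL; apply: F_loc => i iW; rewrite permM tpermD //.
  - by apply: contraNneq pW => ->.
  - by apply: contraNneq jW => ->.
rewrite mulr_natl -sumr_const (eq_bigr _ swap) exchange_big /=.
apply: ler_sum => s _; rewrite [leRHS](reindex_inj (@perm_inj _ s)) /=.
rewrite [leRHS](bigID (mem (~: W))) /=. by rewrite lerDl sumr_ge0.
Qed.

(** The two values are revealed in turn: [sum_perm_reveal] with nothing known gives a factor [n],
    then with [p] known a factor [n.-1]. *)
Lemma sum_perm_pair (p p' x x' : 'I_n) : p != p' ->
  (\sum_(s : 'S_n) ((s p == x) && (s p' == x'))%:R) * (n * n.-1)%:R <=
  #|{perm 'I_n}|%:R :> R.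
Proof.
move=> neq_pp'.
have one : n%:R * (\sum_(s : 'S_n) (s p == x)%:R) <= #|{perm 'I_n}|%:R :> R.
  have := @sum_perm_reveal finset.set0 p (fun _ y => (y == x)%:R).
  rewrite inE finset.setC0 cardsT card_ord => /(_ isT)/(_ _ _)/le_trans; apply=> //.
  rewrite -sumr_const; apply: ler_sum => s _.
  by rewrite (bigD1 x) //= eqxx big1 ?addr0 // => y /negPf ->.
have two : n.-1%:R * (\sum_(s : 'S_n) ((s p == x) && (s p' == x'))%:R)
    <= \sum_(s : 'S_n) (s p == x)%:R :> R.
  have := @sum_perm_reveal [set p]%SET p' (fun s y => ((s p == x) && (y == x'))%:R).
  rewrite inE eq_sym neq_pp' cardsC1 card_ord => /(_ isT)/(_ _ _)/le_trans; apply=> //.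
    by move=> s t st y; rewrite st // inE.
  apply: ler_sum => s _; rewrite (bigD1 x') //= eqxx andbT big1 ?addr0 //.
  by move=> y /negPf ->; rewrite andbF.
apply: le_trans one.
by rewrite natrM mulrC -mulrA ler_wpM2l.
Qed.

(** Induction on [m]: once the earlier positions are revealed, at least [n - N] values remain for
    the next one and at most [d] of them are [D]-related to the current vertex. The new factor thus
    costs [1 + d * c / (n - N)] on average. *)
Lemma sum_perm_walk (D : rel 'I_n) (d : nat) (c : R) (N m : nat) (p : nat -> 'I_n) :
  0 <= c -> (forall x, #|D x| <= d)%N -> (m <= N < n)%N ->
  {in [pred i | (i <= N)%N] &, injective p} ->
  \sum_(s : 'S_n) \prod_(i < m) (1 + c * (D (s (p i)) (s (p i.+1)))%:R) <=
  (1 + d%:R * c / (n - N)%:R) ^+ m * #|{perm 'I_n}|%:R.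
Proof.
move=> c_ge0 degD + p_inj; elim: m => [|m IHm] /andP[le_mN lt_Nn].
  under eq_bigr do rewrite big_ord0.
  by rewrite sumr_const expr0 mul1r.
pose g (s : 'S_n) : R := \prod_(i < m) (1 + c * (D (s (p i)) (s (p i.+1)))%:R).
have g_ge0 s : 0 <= g s.
  by apply: prodr_ge0 => i _; rewrite addr_ge0 ?mulr_ge0 ?ler0n.
have nN_gt0 : 0 < (n - N)%:R :> R by rewrite ltr0n subn_gt0.
(* The positions already revealed; they determine [g], and [p m.+1] is not among them. *)
pose W := [set p (val i) | i : 'I_m.+1]%SET.
have pW i : (i <= m)%N -> p i \in W.
  by move=> le_im; apply/imsetP; exists (inord i) => //=; rewrite inordK.
have step : (n - N)%:R * (\sum_s g s * (D (s (p m)) (s (p m.+1)))%:R) <=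
    d%:R * \sum_s g s.
  apply: (@le_trans _ _ (#|~: W|%:R * \sum_s g s * (D (s (p m)) (s (p m.+1)))%:R)).
    apply: ler_wpM2r; first by apply: sumr_ge0 => s _; rewrite mulr_ge0 ?ler0n.
    rewrite ler_nat cardsCs finset.setCK card_ord leq_sub2l //.
    by rewrite (leq_trans (leq_imset_card _ _)) // card_ord.
  apply: (le_trans (sum_perm_reveal (F := fun s x => g s * (D (s (p m)) x)%:R) _ _ _)).
  - apply/imsetP => -[i _ /p_inj]; rewrite !inE => /(_ le_mN).
    rewrite (ltnW (leq_trans (ltn_ord i) le_mN)) => /(_ isT) mi.
    by have := ltn_ord i; rewrite -mi ltnn.
  - by move=> s x; rewrite mulr_ge0 ?ler0n.
  - move=> s t st x; rewrite st ?pW // /g; congr (_ * _).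
    apply: eq_bigr => i _; rewrite !st ?pW //; exact: ltnW.
  rewrite mulr_sumr; apply: ler_sum => s _.
  rewrite -mulr_sumr mulrC ler_wpM2r // -natr_sum ler_nat.
  by rewrite -big_mkcond sum1_card degD.
have {}IHm := IHm (introT andP (conj (ltnW le_mN) lt_Nn)).
under eq_bigr do rewrite big_ord_recr /= mulrDr mulr1 mulrCA.
rewrite big_split /= -mulr_sumr exprSr mulrAC.
have -> : \sum_s g s + c * (\sum_s g s * (D (s (p m)) (s (p m.+1)))%:R) =
  \sum_s g s + c / (n - N)%:R * ((n - N)%:R * \sum_s g s * (D (s (p m)) (s (p m.+1)))%:R).
  by rewrite mulrA divfK // lt0r_neq0.
apply: (@le_trans _ _ (\sum_s g s + c / (n - N)%:R * (d%:R * \sum_s g s))).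
  by rewrite lerD2l ler_wpM2l // divr_ge0 // ltW.
have -> : \sum_s g s + c / (n - N)%:R * (d%:R * \sum_s g s) =
  (\sum_s g s) * (1 + d%:R * c / (n - N)%:R) by ring.
by rewrite ler_wpM2r // addr_ge0 // divr_ge0 ?mulr_ge0 // ltW.
Qed.

End RandomPermutation.

(** * Edge sets of relabelled paths *)

Section PathCopies.
Variables n k : nat.
Implicit Types (s t : 'S_n.+1) (D : graph n.+1).

(** Indexing through [inord] keeps positions as plain naturals; its default value never arises when
    [k <= n.+1]. *)
Definition path_edges s : graph n.+1 :=
  [set e : edge n.+1 | [exists i : 'I_k.-1,
     val e == [set s (inord i); s (inord i.+1)]%SET]]%SET.

Lemma adj_path_graph (x y : 'I_k) :
  adj (path_graph k) x y = (val y == (val x).+1) || (val x == (val y).+1).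
Proof.
apply/existsP/idP => [[e /andP[]]|].
  rewrite inE => /existsP[i /existsP[j /andP[/eqP-> /eqP ij]]] /eqP/set2_eqP.
  by case=> -[<- <-]; rewrite -ij eqxx ?orbT.
move=> xy; have neq_xy : x != y.
  by apply/eqP => eq_xy; move: xy; rewrite eq_xy orbb => /eqP; lia.
have xy2 : #|[set x; y]%SET| == 2%N by rewrite cards2 neq_xy.
exists (Sub [set x; y]%SET xy2 : edge k); rewrite SubK eqxx andbT inE.
apply/existsP; case/orP: xy => xy.
  by exists x; apply/existsP; exists y; rewrite SubK xy eqxx.
exists y; apply/existsP; exists x; rewrite SubK xy andbT; apply/eqP.
exact: finset.setUC.
Qed.

Lemma image_copy_path (le_kn : (k <= n.+1)%N) s :
  (image_copy (path_graph k) (s \o widen_ord le_kn)).2 = path_edges s.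
Proof.
apply/setP=> e; rewrite !inE; apply/existsP/existsP.
  have wE (x : 'I_k) : widen_ord le_kn x = inord x.
    by apply: val_inj; rewrite /= inordK // (leq_trans (ltn_ord x)).
  case=> x /existsP[y]; rewrite adj_path_graph /= !wE => /andP[/orP[]/eqP xy /eqP eE].
    have ltx : (x < k.-1)%N by have := ltn_ord y; rewrite xy; lia.
    by exists (Ordinal ltx); rewrite eE xy.
  have lty : (y < k.-1)%N by have := ltn_ord x; rewrite xy; lia.
  by exists (Ordinal lty); rewrite eE xy /= finset.setUC.
case=> i /eqP eE.
have lti : (i < k)%N by have := ltn_ord i; lia.
have ltSi : (i.+1 < k)%N by have := ltn_ord i; lia.
exists (Ordinal lti); apply/existsP; exists (Ordinal ltSi).
rewrite adj_path_graph /= eqxx eE /=; apply/eqP; congr [set s _; s _]%SET.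
  by apply: val_inj; rewrite /= inordK // (leq_trans lti).
by apply: val_inj; rewrite /= inordK // (leq_trans ltSi).
Qed.

Lemma sum_edge_adj m (D : graph m) (x y : 'I_m) :
  (\sum_(e in D) (val e == [set x; y]%SET) = adj D x y)%N.
Proof.
case: (boolP (adj D x y)) => [/existsP[e /andP[eD /eqP eE]]|].
  rewrite (bigD1 e) //= eE eqxx big1 ?addn0 // => e' /andP[_ neq_ee'].
  apply/eqP; rewrite eqb0; apply: contra neq_ee' => /eqP e'E.
  by rewrite -val_eqE /= e'E eE.
move/existsPn=> noe; rewrite big1 // => e eD.
by apply/eqP; rewrite eqb0; have := noe e; rewrite eD.
Qed.

Lemma mem_path_edges_le s e :
  ((e \in path_edges s) <=
   \sum_(i < k.-1) (val e == [set s (inord i); s (inord i.+1)]%SET))%N.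
Proof.
rewrite inE; case: existsP => // -[i ei].
by rewrite (bigD1 i) //= ei leq_addr.
Qed.

(** Turns an overlap into a sum along the path of [s], the form in which [s] can be revealed vertex
    by vertex. *)
Lemma card_path_edgesI s D :
  (#|path_edges s :&: D| <=
   \sum_(i < k.-1) adj D (s (inord i)) (s (inord i.+1)))%N.
Proof.
rewrite -sum1_card (eq_bigl (fun e => (e \in D) && (e \in path_edges s))); last first.
  by move=> e; rewrite inE andbC.
rewrite big_mkcondr /=.
under [leqRHS]eq_bigr do rewrite -sum_edge_adj.
rewrite exchange_big /=; apply: leq_sum => e _.
by apply: leq_trans (mem_path_edges_le s e); case: ifP.
Qed.

Lemma path_edges_degree t D x : (k <= n.+1)%N ->
  D \subset path_edges t -> (#|adj D x| <= 2)%N.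
Proof.
move=> le_kn /fintype.subsetP sDt.
pose i := val ((t^-1)%g x).
(* The neighbours of [x] sit just after and just before its position. At the extreme positions
   [i.-1] truncates or [inord] defaults, which is harmless since only a superset of the neighbours
   is needed. *)
apply: (@leq_trans #|[set t (inord i.+1); t (inord i.-1)]%SET|); last first.
  by rewrite cards2; case: eqP.
apply: subset_leq_card; apply/fintype.subsetP => y.
case/existsP=> e /andP[/sDt]; rewrite !inE => /existsP[j /eqP ->] /eqP/set2_eqP.
have ltj1 : (j.+1 < n.+1)%N by have := ltn_ord j; lia.
by rewrite /i; case=> -[<- <-]; rewrite permK /= inordK ?eqxx ?orbT // ltnW.
Qed.

End PathCopies.

(** * Exponential and first moments of the overlap *)

Section PathMoments.
Variables (R : realType) (n k : nat).
Hypothesis le_kn : (k <= n.+1)%N.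
Implicit Types (s t : 'S_n.+1) (D Q : graph n.+1).

Let M : R := #|{perm 'I_n.+1}|%:R.

(** As adjacency is 0 or 1, each factor is [1 + (c - 1) * adj], so [sum_perm_walk] applies with
    [N = m]. From [m.*2 <= n.+1] follows [m <= n.+1 - m], and [1 + x <= expR x] makes the bound free
    of [n]. *)
Lemma sum_expr_walk (c : R) (D : graph n.+1) (a m : nat) :
  1 <= c -> (forall x, #|adj D x| <= 2)%N -> (a + m <= n)%N -> (m.*2 <= n.+1)%N ->
  \sum_(s : 'S_n.+1)
    c ^+ (\sum_(i < m) adj D (s (inord (a + i))) (s (inord (a + i).+1))) <=
  expR (2 * (c - 1)) * M.
Proof.
move=> c_ge1 degD le_amn le_mn.
have c1_ge0 : 0 <= c - 1 by rewrite subr_ge0.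
pose p i : 'I_n.+1 := inord (a + i).
have p_inj : {in [pred i | (i <= m)%N] &, injective p}.
  move=> i j; rewrite !inE => le_im le_jm /(congr1 val) /=.
  by rewrite !inordK; lia.
have le_m : (m <= m < n.+1)%N by lia.
have := @sum_perm_walk R n.+1 (adj D) 2 (c - 1) m m p c1_ge0 degD le_m p_inj.
rewrite -/M.
have -> : \sum_(s : 'S_n.+1)
     \prod_(i < m) (1 + (c - 1) * (adj D (s (p i)) (s (p i.+1)))%:R) =
   \sum_(s : 'S_n.+1)
     c ^+ (\sum_(i < m) adj D (s (inord (a + i))) (s (inord (a + i).+1))).
  apply: eq_bigr => s _; rewrite (big_morph _ (exprD c) (expr0 c)).
  apply: eq_bigr => i _; rewrite /p addnS.
  by case: adj; rewrite ?mulr1 ?mulr0 ?addr0 ?expr1 ?subrKC.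
move/le_trans; apply; apply: ler_wpM2r; first exact: ler0n.
have d_gt0 : 0 < (n.+1 - m)%:R :> R by rewrite ltr0n; lia.
have x_ge0 : 0 <= 2 * (c - 1) / (n.+1 - m)%:R by rewrite divr_ge0 ?mulr_ge0 ?ler0n.
apply: (@le_trans _ _ (expR (2 * (c - 1) / (n.+1 - m)%:R) ^+ m)).
  apply: lerXn2r; rewrite ?nnegrE ?expR_ge0 ?addr_ge0 //; exact: expR_ge1Dx.
rewrite -expRM_natl ler_expR mulrCA -[leRHS]mulr1 ler_wpM2l ?mulr_ge0 //.
by rewrite ler_pdivrMr // mul1r ler_nat; lia.
Qed.

(** A path through nearly all vertices would leave too few free values at its end, hence the cut
    into halves of at most [n.+1] over 2 edges. Decoupling them by AM-GM replaces [c] by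
    [c ^+ 2]. *)
Lemma sum_expr_path_edges (c : R) (D : graph n.+1) : 1 <= c ->
  (forall x, #|adj D x| <= 2)%N ->
  \sum_(s : 'S_n.+1) c ^+ #|path_edges k s :&: D| <= expR (2 * (c ^+ 2 - 1)) * M.
Proof.
move=> c_ge1 degD; pose h := (k.-1)./2.
have c2_ge1 : 1 <= c ^+ 2 by rewrite exprn_ege1.
pose W a m (s : 'S_n.+1) :=
  (\sum_(i < m) adj D (s (inord (a + i))) (s (inord (a + i).+1)))%N.
pose m := (k.-1 - h)%N; have kE : k.-1 = (h + m)%N by rewrite /m /h; lia.
have card_le s : (#|path_edges k s :&: D| <= W 0 h s + W h m s)%N.
  apply: (leq_trans (card_path_edgesI k s D)); rewrite kE big_split_ord; exact: leq_add.
apply: (@le_trans _ _ (\sum_(s : 'S_n.+1)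
    2^-1 * ((c ^+ 2) ^+ W 0 h s + (c ^+ 2) ^+ W h m s))).
  apply: ler_sum => s _; apply: (le_trans (ler_weXn2l c_ge1 (card_le s))).
  rewrite exprD -!exprM ![(2 * _)%N]mulnC !exprM.
  set x := c ^+ _; set y := c ^+ _.
  by have := sqr_ge0 (x - y); nra.
rewrite -mulr_sumr big_split /=.
have b1 : \sum_(s : 'S_n.+1) (c ^+ 2) ^+ W 0 h s <= expR (2 * (c ^+ 2 - 1)) * M.
  by apply: sum_expr_walk => //; rewrite /m /h; lia.
have b2 : \sum_(s : 'S_n.+1) (c ^+ 2) ^+ W h m s <= expR (2 * (c ^+ 2 - 1)) * M.
  by apply: sum_expr_walk => //; rewrite /m /h; lia.
lra.
Qed.

(** Linearity over the edges of [Q]: since [s] and [t] are independent, each edge contributes the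
    square of its chance to lie on one random path. *)
Lemma sum_card_path_edgesI Q : (0 < n)%N ->
  \sum_(s : 'S_n.+1) \sum_(t : 'S_n.+1) #|path_edges k s :&: path_edges k t :&: Q|%:R <=
  #|Q|%:R * (2 * k%:R / (n.+1 * n)%:R * M) ^+ 2 :> R.
Proof.
move=> n_gt0.
have mem_le e : \sum_(s : 'S_n.+1) (e \in path_edges k s)%:R <=
    2 * k%:R / (n.+1 * n)%:R * M.
  have /cards2P[a [b [_ eE]]] := valP e.
  have nn_gt0 : 0 < (n.+1 * n)%:R :> R by rewrite ltr0n muln_gt0.
  have pos_neq (i : 'I_k.-1) : inord i != inord i.+1 :> 'I_n.+1.
    have ltSi : (i.+1 < n.+1)%N by have := ltn_ord i; move: le_kn; lia.
    by rewrite -val_eqE /= !inordK ?neq_ltn ?ltnSn // ltnW.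
  have hit (i : 'I_k.-1) x y :
      \sum_(s : 'S_n.+1) ((s (inord i) == x) && (s (inord i.+1) == y))%:R <=
      M / (n.+1 * n)%:R.
    by rewrite ler_pdivlMr //; exact: (sum_perm_pair R x y (pos_neq i)).
  (* Union bound over the positions on the path and the two orientations of the edge, whence the
     factor [2 * k]. *)
  apply: (@le_trans _ _ (\sum_(s : 'S_n.+1) \sum_(i < k.-1)
      (((s (inord i) == a) && (s (inord i.+1) == b))%:R +
       ((s (inord i) == b) && (s (inord i.+1) == a))%:R))).
    apply: ler_sum => s _.
    apply: (@le_trans _ _ (\sum_(i < k.-1)
        (val e == [set s (inord i); s (inord i.+1)]%SET)%:R)).
      by rewrite -natr_sum ler_nat mem_path_edges_le.
    apply: ler_sum => i _; rewrite eE; case: eqP => [/set2_eqP|_].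
      by case=> -[<- <-]; rewrite !eqxx /= ?lerDl ?lerDr ler0n.
    by rewrite addr_ge0.
  rewrite exchange_big /=.
  apply: (@le_trans _ _ (\sum_(i < k.-1) 2 * (M / (n.+1 * n)%:R))).
    by apply: ler_sum => i _; rewrite big_split mulr_natl mulr2n lerD ?hit.
  rewrite sumr_const card_ord -[leLHS]mulr_natl.
  have -> : 2 * k%:R / (n.+1 * n)%:R * M = k%:R * (2 * (M / (n.+1 * n)%:R)) by ring.
  by rewrite ler_wpM2r ?mulr_ge0 ?divr_ge0 ?ler0n // ler_nat leq_pred.
have -> : \sum_(s : 'S_n.+1) \sum_(t : 'S_n.+1)
      #|path_edges k s :&: path_edges k t :&: Q|%:R =
    \sum_(e in Q) (\sum_(s : 'S_n.+1) (e \in path_edges k s)%:R) ^+ 2 :> R.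
  transitivity (\sum_(s : 'S_n.+1) \sum_(t : 'S_n.+1) \sum_(e in Q)
      ((e \in path_edges k s)%:R * (e \in path_edges k t)%:R : R)).
    apply: eq_bigr => s _; apply: eq_bigr => t _.
    rewrite -sum1_card natr_sum big_mkcond [RHS]big_mkcond /=; apply: eq_bigr => e _.
    rewrite 2!finset.in_setI; case: (e \in path_edges k s); case: (e \in path_edges k t);
      by case: (e \in Q); rewrite /= ?mulr0 ?mul0r ?mulr1.
  rewrite (eq_bigr _ (fun s _ => exchange_big _ _ _ _ _ _)) exchange_big /=.
  apply: eq_bigr => e _; rewrite expr2 mulr_suml.
  by apply: eq_bigr => s _; rewrite mulr_sumr.
rewrite -[#|Q|%:R]sumr_const mulr_suml; apply: ler_sum => e _.
rewrite mul1r lerXn2r ?nnegrE ?mem_le //.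
  by apply: sumr_ge0 => s _; rewrite ler0n.
by rewrite mulr_ge0 ?divr_ge0 ?mulr_ge0 ?ler0n.
Qed.

End PathMoments.

(** Each term is at most [c ^+ X i] times the indicator of [0 < X i]; Cauchy-Schwarz separates the
    two factors, and the indicator is at most [X i]. *)
Lemma sqr_sum_expr_sub1_le (R : realFieldType) (I : finType) (c : R)
    (X : I -> nat) : 1 <= c ->
  (\sum_i (c ^+ X i - 1)) ^+ 2 <= (\sum_i (X i)%:R) * \sum_i (c ^+ 2) ^+ X i.
Proof.
move=> c_ge1.
have pow_ge1 m : 1 <= c ^+ m by exact: exprn_ege1.
apply: (@le_trans _ _ ((\sum_i (0 < X i)%N%:R * c ^+ X i) ^+ 2)).
  rewrite lerXn2r ?nnegrE ?sumr_ge0 // => [i _|i _|].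
  - by rewrite subr_ge0.
  - by rewrite mulr_ge0 ?ler0n // (le_trans ler01).
  - apply: ler_sum => i _; case: (X i) => [|m]; first by rewrite subrr mul0r.
    by rewrite mul1r gerBl.
apply: (le_trans (sqr_sum_mul_le _ _)).
rewrite (eq_bigr (fun i => (c ^+ 2) ^+ X i) (F1 := fun i => (c ^+ X i) ^+ 2)); last first.
  by move=> i _; rewrite -!exprM mulnC.
apply: ler_wpM2r.
  by apply: sumr_ge0 => i _; rewrite exprn_ge0 // (le_trans ler01).
by apply: ler_sum => i _; rewrite -natrX ler_nat; case: (X i).
Qed.

(** * Quantitative bound on the detection advantage *)

Section PathDetection.
Variables (R : realType) (q : R) (n k : nat).
Hypothesis hq : 0 < q < 1.
Hypothesis le_kn : (k <= n.+1)%N.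
Hypothesis n_gt0 : (0 < n)%N.
Implicit Types Q : graph n.+1.

Let M : R := #|{perm 'I_n.+1}|%:R.

Lemma law_of_transcript_planted_path Q :
  law_of (transcript Q) (planted_law q (path_graph k)) =1
  law_of (transcript Q) (fun G => (\sum_(s : 'S_n.+1)
     planted_edges_law q (path_edges k s :&: Q)%SET G) / M).
Proof.
move=> u.
have avg (P : 'S_n.+1 -> graph n.+1 -> R) :
    law_of (transcript Q) (fun G => (\sum_s P s G) / M) u =
    (\sum_s law_of (transcript Q) (P s) u) / M.
  by rewrite /law_of /prob -mulr_suml exchange_big.
transitivity (law_of (transcript Q) (fun G => (\sum_(s : 'S_n.+1)
     planted_edges_law q (path_edges k s) G) / M) u).
  rewrite /law_of /prob; apply: eq_bigr => G _.
  have := sum_copies_perm le_kn (path_graph k) (fun S => planted_edges_law q S.2 G).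
  rewrite /planted_law => ->; congr (_ / _).
  by apply: eq_bigr => s _; rewrite image_copy_path.
rewrite !avg; congr (_ / _); apply: eq_bigr => s _.
by apply: law_of_transcript_restr => e eQ; rewrite !inE eQ andbT.
Qed.

(** The fourth power comes from two uses of Cauchy-Schwarz, one for the chi-square bound and one to
    separate the first moment from the exponential moment. *)
Lemma prob_path_transcript_le Q
    (A : {set {ffun {e : edge n.+1 | e \in Q} -> bool}}) :
  `|prob (law_of (transcript Q) (planted_law q (path_graph k))) A -
    prob (law_of (transcript Q) (@null_law R q n.+1)) A| ^+ 4 <=
  16 * expR (2 * (q^-1 ^+ 4 - 1)) * (#|Q|%:R * k%:R / n.+1%:R ^+ 3).
Proof.
set c := q^-1; set K := expR _.
have c_ge1 : 1 <= c by rewrite invf_ge1; case/andP: hq => // q0 /ltW.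
have c2_ge1 : 1 <= c ^+ 2 by rewrite exprn_ege1.
have M_gt0 : 0 < M by rewrite ltr0n; apply/card_gt0P; exists 1%g.
pose S (s : 'S_n.+1) := (path_edges k s :&: Q)%SET.
pose X (st : 'S_n.+1 * 'S_n.+1) := #|S st.1 :&: S st.2|.
have XE s t : X (s, t) = #|path_edges k s :&: path_edges k t :&: Q|.
  by rewrite /X /S /= finset.setIACA finset.setIid.
set B := \sum_p (c ^+ X p - 1).
have chi2 : `|prob (law_of (transcript Q) (planted_law q (path_graph k))) A -
    prob (law_of (transcript Q) (@null_law R q n.+1)) A| ^+ 2 <= B / M ^+ 2.
  rewrite real_normK ?num_real //.
  under [prob (law_of _ (planted_law _ _)) A]eq_bigr => u _.
    rewrite law_of_transcript_planted_path; over.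
  rewrite -/(prob (law_of _ _) A).
  rewrite !prob_law_of /prob -sumrB /B -(pair_bigA _ (fun s t => c ^+ X (s, t) - 1)) /=.
  by apply: (sqr_prob_mixture_le hq); apply/card_gt0P; exists 1%g.
have sumX : \sum_p (X p)%:R <= #|Q|%:R * (2 * k%:R / (n.+1 * n)%:R * M) ^+ 2 :> R.
  rewrite -(pair_bigA _ (fun s t => (X (s, t))%:R)) /=.
  under eq_bigr do under eq_bigr do rewrite XE.
  exact: sum_card_path_edgesI.
(* For fixed [t] the other path meets a graph of degree at most 2. The base is already [c ^+ 2], and
   the cut into halves squares it again, hence [q^-1 ^+ 4] in [K]. *)
have sumcX : \sum_p (c ^+ 2) ^+ X p <= K * M ^+ 2.
  rewrite -(pair_bigA _ (fun s t => (c ^+ 2) ^+ X (s, t))) exchange_big /=.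
  apply: (@le_trans _ _ (\sum_(t : 'S_n.+1) K * M)).
    apply: ler_sum => t _.
    under eq_bigr do rewrite XE -finset.setIA.
    rewrite /K (exprM c 2 2); apply: sum_expr_path_edges => // x.
    by apply: path_edges_degree le_kn _; exact: subsetIl.
  by rewrite sumr_const -[leLHS]mulr_natr expr2 mulrA.
have B2 : B ^+ 2 <= #|Q|%:R * (2 * k%:R / (n.+1 * n)%:R * M) ^+ 2 * (K * M ^+ 2).
  apply: (le_trans (sqr_sum_expr_sub1_le _ c_ge1)).
  apply: ler_pM => //; apply: sumr_ge0 => p _; first exact: ler0n.
  by rewrite exprn_ge0 // (le_trans ler01).
have B_ge0 : 0 <= B by apply: sumr_ge0 => p _; rewrite subr_ge0 exprn_ege1.
apply: (@le_trans _ _ ((B / M ^+ 2) ^+ 2)).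
  by rewrite (exprM _ 2 2) lerXn2r ?nnegrE ?divr_ge0 ?exprn_ge0 // ltW.
have n1_gt0 : 0 < n.+1%:R :> R by rewrite ltr0n.
have M_neq0 := lt0r_neq0 M_gt0.
have n1_neq0 := lt0r_neq0 n1_gt0.
have n_neq0 : n%:R != 0 :> R by rewrite pnatr_eq0 -lt0n.
(* Since [0 < n], [n.+1 <= 2 * n]; the resulting 4 becomes the constant 16 after squaring. *)
have nn_le : 2 * k%:R / (n.+1 * n)%:R <= 4 * k%:R / n.+1%:R ^+ 2 :> R.
  rewrite ler_pdivrMr ?ltr0n ?muln_gt0 // mulrAC ler_pdivlMr ?exprn_gt0 //.
  have -> : 4 * k%:R * (n.+1 * n)%:R = 2 * k%:R * (2 * (n.+1 * n))%:R :> R.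
    by rewrite (natrM _ 2); ring.
  rewrite -natrX; apply: ler_wpM2l; first by rewrite mulr_ge0.
  rewrite ler_nat -mulnn mulnCA leq_mul2l; apply/orP; right.
  by rewrite mul2n -addnn -addn1 leq_add2l.
have kn1_le : k%:R <= n.+1%:R :> R by rewrite ler_nat.
have p_ge0 : 0 <= 2 * k%:R / (n.+1 * n)%:R :> R by rewrite divr_ge0 ?mulr_ge0 ?ler0n.
have K_ge0 : 0 <= K by exact: expR_ge0.
have -> : (B / M ^+ 2) ^+ 2 = B ^+ 2 / M ^+ 4 by rewrite expr_div_n -exprM.
rewrite ler_pdivrMr ?exprn_gt0 //; apply: (le_trans B2).
have -> : #|Q|%:R * (2 * k%:R / (n.+1 * n)%:R * M) ^+ 2 * (K * M ^+ 2) =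
   K * #|Q|%:R * (2 * k%:R / (n.+1 * n)%:R) ^+ 2 * M ^+ 4 by ring.
rewrite ler_wpM2r ?(ltW (exprn_gt0 4 M_gt0)) //.
apply: (@le_trans _ _ (K * #|Q|%:R * (4 * k%:R / n.+1%:R ^+ 2) ^+ 2)).
  by rewrite ler_wpM2l ?mulr_ge0 ?ler0n // lerXn2r ?nnegrE // (le_trans p_ge0).
(* One factor [k / n.+1], at most 1, is split off and discarded. *)
have -> : K * #|Q|%:R * (4 * k%:R / n.+1%:R ^+ 2) ^+ 2 =
   16 * K * (#|Q|%:R * k%:R / n.+1%:R ^+ 3) * (k%:R / n.+1%:R).
  by field.
rewrite ler_piMr ?mulr_ge0 ?divr_ge0 ?exprn_ge0 ?mulr_ge0 ?ler0n //.
by rewrite ler_pdivrMr // mul1r.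
Qed.

(** The previous bound is uniform in the event and in the query set, so it passes through both
    suprema; the empty event and the empty query set show that these range over nonempty sets. *)
Lemma optimal_risk_path_le (b : nat) (eps : R) : 0 <= eps ->
  16 * expR (2 * (q^-1 ^+ 4 - 1)) * (b%:R * k%:R / n.+1%:R ^+ 3) <= eps ^+ 4 ->
  `|1 - @optimal_risk R q n.+1 k (path_graph k) b| <= eps.
Proof.
move=> eps_ge0 small.
rewrite /optimal_risk; set T := (X in sup X).
have dTV_le Q : (#|Q| <= b)%N ->
    0 <= dTV (law_of (transcript Q) (planted_law q (path_graph k)))
      (law_of (transcript Q) (@null_law R q n.+1)) <= eps.
  move=> le_Qb; rewrite /dTV; set U := (X in sup X).
  have U_ub : ubound U eps.
    move=> _ [A _ <-]; rewrite -(@ler_pXn2r _ 4) ?nnegrE //.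
    apply: (le_trans (prob_path_transcript_le A)); apply: le_trans small.
    rewrite ler_wpM2l ?mulr_ge0 ?expR_ge0 // ler_wpM2r ?invr_ge0 ?exprn_ge0 //.
    by rewrite ler_wpM2r // ler_nat.
  have U_0 : U !=set0 by eexists; exists finset.set0.
  rewrite ge_sup // andbT.
  have [x Ux] := U_0.
  apply: (@le_trans _ _ x); first by case: Ux => A _ <-.
  by apply: ub_le_sup => //; exists eps.
have T_0 : T !=set0 by eexists; exists finset.set0 => //=; rewrite cards0.
have T_ub : ubound T eps by move=> _ [Q /= le_Qb <-]; case/andP: (dTV_le Q le_Qb).
have sup_ge0 : 0 <= sup T.
  have [x Tx] := T_0; apply: (@le_trans _ _ x).
    by case: Tx => Q /= le_Qb <-; case/andP: (dTV_le Q le_Qb).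
  by apply: ub_le_sup => //; exists eps.
by rewrite opprB addrCA subrr addr0 ger0_norm // ge_sup.
Qed.

End PathDetection.

(** * Passage to the limit and the case of full observation *)

Theorem corollary3 (R : realType) (q : R) (hq : 0 < q < 1) (k : nat -> nat)
    (hk : forall n : nat, (2 <= n)%N -> (2 <= k n <= n)%N) :
  (forall b : nat -> nat,
     (b n)%:R * (k n)%:R / n%:R ^+ 3 @[n --> \oo] --> (0 : R) ->
     weak_detection_impossible q (fun n => path_graph (k n)) b) /\
  ((fun n : nat => (k n)%:R : R^o) =o_\oo (fun n : nat => n%:R : R^o) ->
   weak_detection_impossible q (fun n => path_graph (k n))
     (fun n => 'C(n, 2))).
Proof.
have main (b : nat -> nat) :
    (b n)%:R * (k n)%:R / n%:R ^+ 3 @[n --> \oo] --> (0 : R) ->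
    weak_detection_impossible q (fun n => path_graph (k n)) b.
  move=> bk0; apply/cvgrPdist_le => eps eps_gt0.
  set C := 16 * expR (2 * (q^-1 ^+ 4 - 1)).
  have C_gt0 : 0 < C by rewrite mulr_gt0 ?expR_gt0.
  have d_gt0 : 0 < eps ^+ 4 / C by rewrite divr_gt0 ?exprn_gt0.
  have /cvgrPdist_le/(_ _ d_gt0) := bk0.
  apply: filterS2 (nbhs_infty_ge 2) => -[|n] //= le2n.
  rewrite sub0r normrN ger0_norm; last by rewrite divr_ge0 ?mulr_ge0 ?exprn_ge0.
  rewrite ler_pdivlMr // mulrC => small.
  have /andP[_ le_kn] := hk _ le2n.
  by apply: (optimal_risk_path_le hq le_kn) small => //; rewrite ltW.
split=> [|ko]; first exact: main.
(* Full observation is a budget of at most [n ^+ 2], so the ratio to control is at most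
   [k n / n]. *)
apply: main; apply/cvgrPdist_le => eps eps_gt0.
have /eqoP/(_ _ eps_gt0) := ko.
apply: filterS2 (nbhs_infty_gt 0) => n n_gt0; rewrite !normr_nat => le_k.
rewrite sub0r normrN ger0_norm; last by rewrite divr_ge0 ?mulr_ge0 ?exprn_ge0.
rewrite ler_pdivrMr ?exprn_gt0 ?ltr0n //.
apply: (@le_trans _ _ (n%:R ^+ 2 * (k n)%:R)).
  by rewrite ler_wpM2r // -natrX ler_nat bin2 -mulnn; nia.
have -> : eps * n%:R ^+ 3 = n%:R ^+ 2 * (eps * n%:R) by ring.
by rewrite ler_wpM2l ?exprn_ge0.
Qed.
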